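(* Let $N\ge4$, let $|\phi\rangle_{A_1\cdots A_N}$ be an $N$-qubit pure state, and let $i\ne j$ be two of the systems $A_1,\dots,A_N$. If $|\phi\rangle_{A_1\cdots A_N}\in SEP(G_i:G_j)$ for a bipartition $\{G_i|G_j\}$ of the whole system with $i\in G_i$ and $j\in G_j$, then $$F_{ij}^{(N)}\left(|\phi\rangle_{A_1\cdots A_N}\right)=\bar F_{ij}^{(N)}\left(|\phi\rangle_{A_1\cdots A_N}\right)=\frac23 .$$
   Context: States of $N$ qubits $A_1,\dots,A_N$ are density operators on $(\mathbb{C}^2)^{\otimes N}$; pure states are unit vectors. $|\psi\rangle_{S_1S_2}\in SEP(S_1:S_2)$ means that the pure state is separable (a product vector) between $S_1$ and $S_2$. Fully entangled fraction: for a two-qubit state $\rho$, $f(\rho)=\max_{|e\rangle}\langle e|\rho|e\rangle$, the maximum being over all maximally entangled unit vectors $|e\rangle\in\mathbb{C}^2\otimes\mathbb{C}^2$ (both reduced states equal to $I/2$). For distinct systems $i,j$ let $K=\{k_1,\dots,k_{N-2}\}=\{A_1,\dots,A_N\}\setminus\{i,j\}$. Define, for $N\ge3$, $$f_{ij}^{(N)}(\rho)=\max_{U_K}\sum_{J\in\{0,1\}^{N-2}}\langle J|U_K\rho_KU_K^\dagger|J\rangle\, f\!\left(\rho_{ij}^{U_K,J}\right),$$ where $U_K=U_{k_1}\otimes\cdots\otimes U_{k_{N-2}}$ ranges over products of one-qubit unitaries, $\rho_K$ is the reduced state of $\rho$ on $K$, and $\rho_{ij}^{U_K,J}$ is the normalized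 state of $i,j$ after each $k_l\in K$ is measured in the basis $\{U_{k_l}^\dagger|0\rangle,U_{k_l}^\dagger|1\rangle\}$ with joint outcome $J$. For $N\ge4$ define $$\bar f_{ij}^{(N)}(\rho)=\max_{k_l\in K}\left(\max_{U_{k_l}}\sum_{t=0}^1\langle t|U_{k_l}\rho_{k_l}U_{k_l}^\dagger|t\rangle\, f_{ij}^{(N-1)}\!\left(\rho^{U_{k_l},t}\right)\right),$$ where $U_{k_l}$ ranges over one-qubit unitaries, $\rho_{k_l}$ is the reduced state of $k_l$, and $\rho^{U_{k_l},t}$ is the normalized state of the remaining $N-1$ qubits after measuring $k_l$ in the basis $\{U_{k_l}^\dagger|0\rangle,U_{k_l}^\dagger|1\rangle\}$ with outcome $t$. Zero-probability terms count as $0$. Finally $$F_{ij}^{(N)}=\frac{2f_{ij}^{(N)}+1}{3},\qquad \bar F_{ij}^{(N)}=\frac{2\bar f_{ij}^{(N)}+1}{3}.$$ *)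

(* Defs.v *)
From HB Require Import structures.
From mathcomp Require Import all_boot all_order all_algebra.
From mathcomp Require Import complex.
From mathcomp Require Import boolp classical_sets reals.

Set Implicit Arguments.
Unset Strict Implicit.
Unset Printing Implicit Defensive.

Import Order.TTheory GRing.Theory Num.Theory.
Local Open Scope ring_scope.
Local Open Scope complex_scope.
Local Open Scope sesquilinear_scope.

(* Maximum of a set of reals: an element of A bounding A from above.  The value
   is 0 if A has no such element. *)
Definition maxr (R : realType) (A : set R) : R := xget 0 (A `&` ubound A)%classic.

(* A register is a finite type I of qubits.  Its Hilbert space has the
   computational basis {0,1}^I; rows and columns of vectors and operators are
   indexed by that basis through enum_rank/enum_val. *)
Notation bits I := {ffun I -> 'I_2}.
Notation ket R I := 'cV[R[i]]_#|bits I|.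
Notation op R I := 'M[R[i]]_#|bits I|.

(* The register formed by the qubits that belong to S. *)
Notation subreg S := {k | k \in S}.

Definition bket (R : realType) (I : finType) (x : bits I) : ket R I :=
  delta_mx (enum_rank x) 0.

Definition proj (R : realType) (I : finType) (v : ket R I) : op R I :=
  v *m v^t*.

Definition expect (R : realType) (I : finType) (v : ket R I) (A : op R I) : R[i] :=
  (v^t* *m A *m v) 0 0.

Definition restr (I : finType) (S : {set I}) (z : bits I) : bits (subreg S) :=
  [ffun k => z (val k)].

(* The two tensor products below are meant for complementary S and T: then
   z |-> (restr S z, restr T z) identifies {0,1}^I with {0,1}^S * {0,1}^T. *)
Definition tensor_ket (R : realType) (I : finType) (S T : {set I})
    (a : ket R (subreg S)) (b : ket R (subreg T)) : ket R I :=
  \col_m let z := enum_val m in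
    a (enum_rank (restr S z)) 0 * b (enum_rank (restr T z)) 0.

Definition tensor_op (R : realType) (I : finType) (S T : {set I})
    (A : op R (subreg S)) (B : op R (subreg T)) : op R I :=
  \matrix_(m, n) let z := enum_val m in let w := enum_val n in
    A (enum_rank (restr S z)) (enum_rank (restr S w)) *
    B (enum_rank (restr T z)) (enum_rank (restr T w)).

Definition local_op (R : realType) (I : finType) (U : I -> 'M[R[i]]_2) : op R I :=
  \matrix_(m, n) let x : bits I := enum_val m in let y : bits I := enum_val n in
    \prod_(k : I) U k (x k) (y k).

(* Partial trace over the qubits outside S. *)
Definition reduced (R : realType) (I : finType) (S : {set I}) (rho : op R I) :
    op R (subreg S) :=
  \matrix_(m, n)
    \sum_(z : bits I | restr S z == enum_val m)
    \sum_(w : bits I | (restr S w == enum_val n)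
                       && (restr (~: S) w == restr (~: S) z))
      rho (enum_rank z) (enum_rank w).

(* Meant for a register I of exactly two qubits: both one-qubit marginals of
   the unit vector e are maximally mixed. *)
Definition max_entangled (R : realType) (I : finType) (e : ket R I) : Prop :=
  e^t* *m e = 1%:M /\
  forall q : I, reduced [set q] (proj e) = (2%:R^-1)%:M.

(* Meant for a density operator rho, for which <e|rho|e> is real. *)
Definition fef (R : realType) (I : finType) (rho : op R I) : R :=
  maxr [set v | exists2 e : ket R I,
    max_entangled e & v = complex.Re (expect e rho)]%classic.

(* Every qubit k outside S is measured in the basis {U_k^* |0>, U_k^* |1>}. *)
Definition outcome_prob (R : realType) (I : finType) (S : {set I})
    (U : subreg (~: S) -> 'M[R[i]]_2) (rho : op R I)
    (J : bits (subreg (~: S))) : R[i] :=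
  expect (bket R J) (local_op U *m reduced (~: S) rho *m (local_op U)^t*).

Definition post_state (R : realType) (I : finType) (S : {set I})
    (U : subreg (~: S) -> 'M[R[i]]_2) (rho : op R I)
    (J : bits (subreg (~: S))) : op R (subreg S) :=
  let P := tensor_op (S := S) 1%:M (proj ((local_op U)^t* *m bket R J)) in
  (outcome_prob U rho J)^-1 *: reduced S (P *m rho *m P^t*).

(* Outcomes of probability zero contribute 0, whatever post_state is there. *)
Definition measured_mean (R : realType) (I : finType) (S : {set I})
    (U : subreg (~: S) -> 'M[R[i]]_2) (g : op R (subreg S) -> R) (rho : op R I) : R :=
  \sum_(J : bits (subreg (~: S)))
    complex.Re (outcome_prob U rho J) * g (post_state U rho J).

(* Maximal mean of g over product measurements of all the qubits outside S. *)
Definition assisted (R : realType) (I : finType) (S : {set I})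
    (g : op R (subreg S) -> R) (rho : op R I) : R :=
  maxr [set v | exists2 U : subreg (~: S) -> 'M[R[i]]_2,
    (forall k, U k \is unitarymx) & v = measured_mean U g rho]%classic.

(* The number N of qubits of the register is #|I|. *)
Definition f_ij (R : realType) (I : finType) (i j : I) (rho : op R I) : R :=
  assisted (S := [set i; j]) (@fef R _) rho.

(* Qubit k is measured first.  The proofs hi and hj say i != k and j != k; they
   let i and j be seen as qubits of the register without k. *)
Definition fbar_ij (R : realType) (I : finType) (i j : I) (rho : op R I) : R :=
  maxr [set v | exists (k : I) (hi : i \in [set~ k]%SET) (hj : j \in [set~ k]%SET),
    v = assisted (S := [set~ k])
          (f_ij (exist _ i hi : subreg [set~ k]%SET) (exist _ j hj)) rho]%classic.

Definition F_ij (R : realType) (I : finType) (i j : I) (rho : op R I) : R :=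
  (2%:R * f_ij i j rho + 1) / 3%:R.

Definition Fbar_ij (R : realType) (I : finType) (i j : I) (rho : op R I) : R :=
  (2%:R * fbar_ij i j rho + 1) / 3%:R.

Definition SEP (R : realType) (I : finType) (S T : {set I}) (phi : ket R I) : Prop :=
  exists (a : ket R (subreg S)) (b : ket R (subreg T)), phi = tensor_ket a b.

(* Main.v *)
(* For a product vector, <z|v><w|v> is unchanged when z and w exchange their bits
   inside G.  A rank-one product measurement of some qubits keeps the state pure
   and keeps this property, because its outcome vectors are themselves products,
   so every branch of positive probability leaves i and j in a pure product state.
   Such a state has fully entangled fraction 1/2 (as a singular 2x2 matrix M its
   overlap with a maximally entangled E is the trace of E^* M), and averaging the
   constant 1/2 over the outcomes gives 1/2 for every choice of measurement. *)

Require Import Defs.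
From HB Require Import structures.
From mathcomp Require Import all_boot all_order all_algebra.
From mathcomp Require Import complex.
From mathcomp Require Import boolp classical_sets reals.
From mathcomp Require Import ring.

Set Implicit Arguments.
Unset Strict Implicit.
Unset Printing Implicit Defensive.

Import Order.TTheory GRing.Theory Num.Theory.
Local Open Scope ring_scope.
Local Open Scope complex_scope.
Local Open Scope sesquilinear_scope.

(** * Traces and overlaps of 2x2 matrices *)

(** By the triangle inequality it suffices to bound (|x| + |w|)^2. Singularity turns the cross term
    2|x||w| into 2|y||z|, and the gap is then (|y| - |z|)^2. *)
Lemma singular_mxtrace_sqr_le (C : numClosedFieldType) (x y z w : C) :
  x * w = y * z ->
  `|x + w| ^+ 2 <= `|x| ^+ 2 + `|y| ^+ 2 + `|z| ^+ 2 + `|w| ^+ 2.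
Proof.
move=> xw_yz.
apply: (@le_trans _ _ ((`|x| + `|w|) ^+ 2)).
  by rewrite lerXn2r ?nnegrE ?addr_ge0 ?ler_normD.
rewrite sqrrD -normrM xw_yz normrM -subr_ge0.
rewrite [leRHS](_ : _ = (`|y| - `|z|) ^+ 2); last by ring.
by rewrite real_exprn_even_ge0 ?rpredB ?normr_real.
Qed.

(* The overlap is the trace of the singular matrix [E^* M], whose Hilbert-Schmidt
   norm is that of [M] divided by sqrt 2. *)
Lemma max_entangled_overlap_le (C : numClosedFieldType)
    (e00 e01 e10 e11 m00 m01 m10 m11 : C) :
  e00 * (e00^*)%R + e01 * (e01^*)%R = 2^-1 ->
  e10 * (e10^*)%R + e11 * (e11^*)%R = 2^-1 ->
  e00 * (e10^*)%R + e01 * (e11^*)%R = 0 ->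
  e10 * (e00^*)%R + e11 * (e01^*)%R = 0 ->
  m00 * m11 = m01 * m10 ->
  m00 * (m00^*)%R + m01 * (m01^*)%R + (m10 * (m10^*)%R + m11 * (m11^*)%R) = 1 ->
  `|(e00^*)%R * m00 + (e01^*)%R * m01
    + ((e10^*)%R * m10 + (e11^*)%R * m11)| ^+ 2 <= 2^-1.
Proof.
move=> h0 h1 h01 h10 hd hm.
(* [x], [y], [z], [w] are the entries 00, 01, 10, 11 of E^* M. *)
set x := (e00^*)%R * m00 + (e10^*)%R * m10.
set w := (e01^*)%R * m01 + (e11^*)%R * m11.
set y := (e00^*)%R * m01 + (e10^*)%R * m11.
set z := (e01^*)%R * m00 + (e11^*)%R * m10.
rewrite [X in `|X|](_ : _ = x + w); last by rewrite /x /w; ring.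
have hs : `|x| ^+ 2 + `|y| ^+ 2 + `|z| ^+ 2 + `|w| ^+ 2 = 2^-1.
  rewrite !normCK /x /y /z /w !rmorphD !rmorphM /= !conjCK.
  transitivity
    ((e00 * (e00^*)%R + e01 * (e01^*)%R) * (m00 * (m00^*)%R + m01 * (m01^*)%R)
    + (e10 * (e10^*)%R + e11 * (e11^*)%R) * (m10 * (m10^*)%R + m11 * (m11^*)%R)
    + (e00 * (e10^*)%R + e01 * (e11^*)%R) * (m10 * (m00^*)%R + m11 * (m01^*)%R)
    + (e10 * (e00^*)%R + e11 * (e01^*)%R) * (m00 * (m10^*)%R + m01 * (m11^*)%R)).
    by ring.
  by rewrite h0 h1 h01 h10 !mul0r !addr0 -mulrDr hm mulr1.
rewrite -hs; apply: singular_mxtrace_sqr_le.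
apply/eqP; rewrite -subr_eq0; apply/eqP.
transitivity (((e00^*)%R * (e11^*)%R - (e01^*)%R * (e10^*)%R)
    * (m00 * m11 - m01 * m10)); first by rewrite /x /y /z /w; ring.
by rewrite hd subrr mulr0.
Qed.

(** * Bits, maxima and kets *)

Lemma ord2_cases (s : 'I_2) : s = 0 \/ s = 1.
Proof. by case: s => [[|[|?]] ?] //; [left|right]; apply: val_inj. Qed.

Lemma sum_ord2 (V : nmodType) (F : 'I_2 -> V) : \sum_s F s = F 0 + F 1.
Proof.
by rewrite !big_ord_recl big_ord0 addr0; congr (F _ + F _); apply: val_inj.
Qed.

Lemma sum_enum_rank (V : nmodType) (T : finType) (F : 'I_#|T| -> V) :
  \sum_m F m = \sum_x F (enum_rank x).
Proof. by rewrite (reindex (@enum_rank T)) //; apply/onW_bij/enum_rank_bij. Qed.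

Lemma maxr_eq (R : realType) (A : set R) (c : R) : A c -> ubound A c -> maxr A = c.
Proof.
move=> Ac uc; apply: xget_unique => // d [Ad ud]; apply/eqP.
by rewrite eq_le uc ?ud.
Qed.

Lemma proj_entry (R : realType) (I : finType) (v : ket R I) m n :
  proj v m n = v m 0 * (v n 0)^*%R.
Proof. by rewrite /proj mxE big_ord1 !mxE. Qed.

Lemma expect_proj (R : realType) (I : finType) (e v : ket R I) :
  expect e (proj v) = `|\sum_z (e (enum_rank z) 0)^*%R * v (enum_rank z) 0| ^+ 2.
Proof.
rewrite /expect /proj !mulmxA -mulmxA mxE big_ord1 normCK; congr (_ * _).
  by rewrite mxE sum_enum_rank; apply: eq_bigr => z _; rewrite !mxE.
rewrite mxE sum_enum_rank rmorph_sum; apply: eq_bigr => z _ /=.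
by rewrite !mxE rmorphM /= conjCK mulrC.
Qed.

Lemma ket_norm (R : realType) (I : finType) (v : ket R I) :
  (v^t* *m v) 0 0 = \sum_z v (enum_rank z) 0 * (v (enum_rank z) 0)^*%R.
Proof.
by rewrite mxE sum_enum_rank; apply: eq_bigr => z _; rewrite !mxE mulrC.
Qed.

Lemma ket_unitP (R : realType) (I : finType) (v : ket R I) :
  v^t* *m v = 1%:M <-> \sum_z v (enum_rank z) 0 * (v (enum_rank z) 0)^*%R = 1.
Proof.
rewrite -ket_norm; split=> [->|h]; first by rewrite mxE eqxx.
by apply/matrixP=> m n; rewrite !ord1 h mxE eqxx.
Qed.

Definition mix (I : finType) (G : {set I}) (z w : bits I) : bits I :=
  [ffun k => if k \in G then z k else w k].

(* Equivalent to [SEP G (~: G) v], but free of the subregister types. *)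
Definition product_across (R : realType) (I : finType) (G : {set I}) (v : ket R I) :=
  forall z w, v (enum_rank z) 0 * v (enum_rank w) 0 =
    v (enum_rank (mix G z w)) 0 * v (enum_rank (mix G w z)) 0.

(** * Fully entangled fraction of a two-qubit product vector *)

Section TwoQubits.
Variables (R : realType) (I : finType).

(** The second qubit stays implicit: on a register with qubits [p] and [q] only, [t] is the bit at
    [q]. *)
Definition pair_bits (p : I) (s t : 'I_2) : bits I :=
  [ffun k => if k == p then s else t].

Lemma sum_pair_bits (p q : I) (V : nmodType) (F : bits I -> V) :
    p != q -> (forall k, (k == p) || (k == q)) ->
  \sum_z F z = \sum_s \sum_t F (pair_bits p s t).
Proof.
move=> pq Ipq; have qp : q != p by rewrite eq_sym.
rewrite pair_bigA /= (reindex (fun st => pair_bits p st.1 st.2)) //=.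
exists (fun z : bits I => (z p, z q)) => [[s t] _|z _] /=.
  by rewrite !ffunE eqxx (negPf qp).
apply/ffunP=> k; rewrite ffunE; case: ifPn => [/eqP->//|kp].
by move: (Ipq k); rewrite (negPf kp) => /eqP->.
Qed.

Lemma pair_bits_swap (p q : I) s t :
  p != q -> (forall k, (k == p) || (k == q)) -> pair_bits q t s = pair_bits p s t.
Proof.
move=> pq Ipq; apply/ffunP => k; rewrite !ffunE.
by case/orP: (Ipq k) => /eqP->; rewrite ?eqxx ?(negPf pq) 1?eq_sym ?(negPf pq).
Qed.

Lemma restr_eqE (S : {set I}) (z : bits I) (x : bits (subreg S)) :
  (restr S z == x) = [forall k, z (val k) == x k].
Proof.
apply/eqP/forallP => [<- k|h]; first by rewrite ffunE.
by apply/ffunP=> k; rewrite ffunE; apply/eqP.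
Qed.

Lemma restr1E (q : I) (z : bits I) (x : bits (subreg [set q]%SET)) :
  (restr [set q]%SET z == x) = (z q == x (exist _ q (set11 q))).
Proof.
rewrite restr_eqE; apply/forallP/idP => [/(_ (exist _ q (set11 q)))//|h [k kq]].
have kE : k = q by apply/set1P.
subst k; by rewrite (bool_irrelevance kq (set11 q)).
Qed.

Lemma restrC1E (p q : I) (z w : bits I) :
    p != q -> (forall k, (k == p) || (k == q)) ->
  (restr (~: [set q])%SET z == restr (~: [set q])%SET w) = (z p == w p).
Proof.
move=> pq Ipq; have pI : p \in (~: [set q])%SET by rewrite !inE.
rewrite restr_eqE; apply/forallP/idP => [/(_ (exist _ p pI))|h [k kq]].
  by rewrite ffunE.
rewrite ffunE /=; move: (kq) (Ipq k); rewrite !inE => /negPf->.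
by rewrite orbF => /eqP->.
Qed.

Lemma reduced1E (p q : I) (rho : op R I) m n :
    p != q -> (forall k, (k == p) || (k == q)) ->
  let bit (l : 'I_#|bits (subreg [set q]%SET)|) :=
    (enum_val l : bits _) (exist _ q (set11 q)) in
  reduced [set q]%SET rho m n =
    \sum_u rho (enum_rank (pair_bits p u (bit m))) (enum_rank (pair_bits p u (bit n))).
Proof.
move=> pq Ipq /=; have qp : q != p by rewrite eq_sym.
rewrite mxE.
rewrite (eq_bigl _ _ (fun z => restr1E z (enum_val m : bits _))).
under eq_bigr => z _.
  rewrite (eq_bigl (fun w : bits I =>
      (w q == (enum_val n : bits _) (exist _ q (set11 q))) && (w p == z p)));
    last by move=> w; rewrite restr1E (restrC1E _ _ pq Ipq).
  over.
set s := enum_val m _; set t := enum_val n _.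
(* The filters fix both bits at [q] and force [w] to agree with [z] at [p], so only the common bit
   [u] at [p] remains to be summed. *)
rewrite big_mkcond (sum_pair_bits _ pq Ipq); apply: eq_bigr => u _.
rewrite (bigD1 s) //= [X in _ + X]big1 => [|s' s's]; last first.
  by rewrite !ffunE (negPf qp) (negPf s's).
rewrite addr0 ffunE (negPf qp) eqxx.
rewrite big_mkcond (sum_pair_bits _ pq Ipq) (bigD1 u) //=.
rewrite [X in _ + X]big1 => [|u' u'u]; last first.
  by rewrite big1 // => t' _; rewrite !ffunE eqxx (negPf u'u) andbF.
rewrite addr0 (bigD1 t) //= [X in _ + X]big1 => [|t' t't]; last first.
  by rewrite !ffunE (negPf qp) (negPf t't).
by rewrite !ffunE addr0 !eqxx (negPf qp) eqxx.
Qed.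

(** Brings the marginal condition of [max_entangled] to the scalar equations that
    [max_entangled_overlap_le] takes. *)
Lemma reduced1_half (p q : I) (rho : op R I) :
    p != q -> (forall k, (k == p) || (k == q)) ->
  reduced [set q]%SET rho = (2%:R^-1)%:M <->
  forall s t, \sum_u rho (enum_rank (pair_bits p u s)) (enum_rank (pair_bits p u t))
    = 2%:R^-1 *+ (s == t).
Proof.
move=> pq Ipq; split=> [h s t|h].
  have := congr1 (fun A : 'M__ => A (enum_rank [ffun=> s]) (enum_rank [ffun=> t])) h.
  rewrite (reduced1E _ _ _ pq Ipq) /= !enum_rankK !ffunE => ->; rewrite mxE.
  congr (_ *+ nat_of_bool _); apply/eqP/eqP => [/enum_rank_inj/ffunP|->//].
  by move/(_ (exist _ q (set11 q))); rewrite !ffunE.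
apply/matrixP=> m n; rewrite (reduced1E _ _ _ pq Ipq) h mxE.
congr (_ *+ nat_of_bool _); apply/eqP/eqP => [st|->//].
apply/enum_val_inj/ffunP => -[k kq]; have kE : k = q by apply/set1P.
by subst k; rewrite (bool_irrelevance kq (set11 q)).
Qed.

Lemma Re_le (x y : R[i]) : x <= y -> complex.Re x <= complex.Re y.
Proof. by rewrite lecE => /andP[]. Qed.

Lemma Re_half : complex.Re (2%:R^-1 : R[i]) = 2%:R^-1.
Proof.
by rewrite (_ : 2%:R^-1 = (2%:R^-1)%:C) // fmorphV rmorph_nat.
Qed.

(** The amplitudes of [v] form a singular 2x2 matrix [m] with row index at [p]. The overlap lemma
    gives the upper bound; since [maxr] needs an attained bound, a maximally entangled [e] reaching
    1/2 is also constructed. *)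
Lemma fef_product (p q : I) (G : {set I}) (v : ket R I) :
    p != q -> (forall k, (k == p) || (k == q)) -> p \in G -> q \notin G ->
    v^t* *m v = 1%:M -> product_across G v ->
  fef (proj v) = 2%:R^-1.
Proof.
move=> pq Ipq pG qG /ket_unitP v1 vG.
have qp : q != p by rewrite eq_sym.
have Iqp k : (k == q) || (k == p) by rewrite orbC.
pose m s t := v (enum_rank (pair_bits p s t)) 0.
(* Exchanging the bits at [p] between the strings 00 and 11 gives 01 and 10. *)
have det0 : m 0 0 * m 1 1 = m 0 1 * m 1 0.
  rewrite /m vG; congr (v (enum_rank _) 0 * v (enum_rank _) 0); apply/ffunP => k;
  by rewrite !ffunE; case/orP: (Ipq k) => /eqP->;
    rewrite ?pG ?(negPf qG) ?eqxx ?(negPf qp).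
move: v1; rewrite (sum_pair_bits _ pq Ipq) !sum_ord2 -!/(m _ _) => v1.
apply: maxr_eq => [/=|r [e [e1 er]] ->]; last first.
  have /(reduced1_half _ qp Iqp) he := er p.
  rewrite -Re_half; apply: Re_le.
  rewrite expect_proj (sum_pair_bits _ pq Ipq) !sum_ord2 -!/(m _ _).
  (* The marginal at [p], which traces out [q], is E E^* for the amplitude matrix E of [e]. *)
  have hst s t : \sum_u e (enum_rank (pair_bits p s u)) 0
      * (e (enum_rank (pair_bits p t u)) 0)^*%R = 2%:R^-1 *+ (s == t).
    rewrite -he; apply: eq_bigr => u _.
    by rewrite proj_entry !(pair_bits_swap _ _ pq Ipq).
  have := (hst 0 0, hst 1 1, hst 0 1, hst 1 0).
  rewrite !sum_ord2 /= mulr0n !mulr1n => -[[[h0 h1] h01] h10].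
  exact: max_entangled_overlap_le.
(* [e] is [m + conj (cofactor m)], divided by sqrt 2. *)
pose n s t := (m s t)^*%R.
have det0' : n 0 0 * n 1 1 = n 0 1 * n 1 0 by rewrite /n -!rmorphM det0.
pose c : R[i] := (sqrtC 2%:R)^-1.
have cr : c^*%R = c by apply/CrealP; rewrite rpredV sqrtC_real.
have cc : c * c = 2%:R^-1 by rewrite -expr2 exprVn sqrtCK.
(* In ['I_2], [1 - s] is the flipped bit, and the power of -1 is the cofactor sign. *)
pose E (s t : 'I_2) := c * (m s t + (-1) ^+ (s != t) * n (1 - s) (1 - t)).
pose e : ket R I := \col_l let z : bits I := enum_val l in E (z p) (z q).
have eE s t : e (enum_rank (pair_bits p s t)) 0 = E s t.
  by rewrite mxE /= enum_rankK !ffunE eqxx (negPf qp).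
have E00 : E 0 0 = c * (m 0 0 + n 1 1) by rewrite /E subr0 mul1r.
have E11 : E 1 1 = c * (m 1 1 + n 0 0) by rewrite /E subrr mul1r.
have E01 : E 0 1 = c * (m 0 1 - n 1 0) by rewrite /E subr0 subrr mulN1r.
have E10 : E 1 0 = c * (m 1 0 - n 0 1) by rewrite /E subr0 subrr mulN1r.
have EE := (E00, E11, E01, E10).
have nm s t : (n s t)^*%R = m s t by rewrite /n conjCK.
have mn s t : (m s t)^*%R = n s t by [].
move: v1; rewrite !mn => v1.
(* Each diagonal entry of a marginal of [e] expands to c^2 times the squared norm of [v] plus det m
   and its conjugate, both zero. *)
have red0 x : x = c * c * (m 0 0 * n 0 0 + m 0 1 * n 0 1
      + (m 1 0 * n 1 0 + m 1 1 * n 1 1)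
      + (m 0 0 * m 1 1 - m 0 1 * m 1 0) + (n 0 0 * n 1 1 - n 0 1 * n 1 0)) ->
    x = 2%:R^-1.
  by rewrite v1 det0 det0' !subrr !addr0 mulr1 cc.
exists e; first split.
- apply/ket_unitP; rewrite (sum_pair_bits _ pq Ipq) !sum_ord2 !eE !EE.
  rewrite !rmorphM !rmorphB !rmorphD /= !nm !mn cr.
  (* Each row of E contributes 1/2 to the squared norm. *)
  rewrite [RHS](_ : _ = 2%:R^-1 + 2%:R^-1).
    congr (_ + _); apply: red0; ring.
  by rewrite -mulr2n -[RHS]mulr_natl mulfV ?pnatr_eq0.
- move=> a; case/orP: (Ipq a) => /eqP->.
    apply/(reduced1_half _ qp Iqp) => s t.
    rewrite sum_ord2 !(pair_bits_swap _ _ pq Ipq) !proj_entry !eE.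
    case: (ord2_cases s) => ->; case: (ord2_cases t) => ->;
    rewrite !EE !rmorphM ?rmorphB ?rmorphD /= !nm !mn cr ?mulr0n ?mulr1n;
    by [ring | apply: red0; ring].
  apply/(reduced1_half _ pq Ipq) => s t.
  rewrite sum_ord2 !proj_entry !eE.
  case: (ord2_cases s) => ->; case: (ord2_cases t) => ->;
  rewrite !EE !rmorphM ?rmorphB ?rmorphD /= !nm !mn cr ?mulr0n ?mulr1n;
  by [ring | apply: red0; ring].
- rewrite -Re_half; apply: congr1.
  rewrite expect_proj (sum_pair_bits _ pq Ipq) !sum_ord2 !eE -!/(m _ _) !EE.
  rewrite !rmorphM !rmorphB !rmorphD /= !nm !mn cr.
  (* The overlap is c (1 + 2 det m) = c. *)
  rewrite [X in `|X|](_ : _ = c).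
    by rewrite normCK cr cc.
  transitivity (c * (m 0 0 * n 0 0 + m 0 1 * n 0 1
      + (m 1 0 * n 1 0 + m 1 1 * n 1 1)
      + (m 0 0 * m 1 1 - m 0 1 * m 1 0) + (m 0 0 * m 1 1 - m 0 1 * m 1 0))).
    ring.
  by rewrite v1 det0 !subrr !addr0 mulr1.
Qed.
End TwoQubits.

(** * Exchanging the bits inside G *)

Lemma sep_product (R : realType) (I : finType) (G : {set I}) (v : ket R I) :
  SEP G (~: G)%SET v -> product_across G v.
Proof.
move=> [a [b ->]] z w; rewrite !mxE /= !enum_rankK.
have rG x y : restr G (mix G x y) = restr G x.
  by apply/ffunP => -[k kG]; rewrite !ffunE /= kG.
have rC x y : restr (~: G)%SET (mix G x y) = restr (~: G)%SET y.
  by apply/ffunP => -[k kG]; rewrite !ffunE /=; move: (kG); rewrite inE => /negPf->.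
by rewrite !rG !rC; ring.
Qed.

(** The exchange is an involution on pairs of bit strings. *)
Lemma big_swap_mix (V : nmodType) (I : finType) (G : {set I})
    (F : bits I -> bits I -> V) :
  \sum_z \sum_w F z w = \sum_z \sum_w F (mix G z w) (mix G w z).
Proof.
rewrite !pair_bigA /= (reindex (fun zw => (mix G zw.1 zw.2, mix G zw.2 zw.1))) //=.
apply/onW_bij/inv_bij => -[z w] /=; congr (_, _); apply/ffunP => k.
all: rewrite !ffunE; by case: (k \in G).
Qed.

(** * Splitting bit strings between S and its complement *)

Section Glue.
Variables (I : finType) (S : {set I}).
Local Notation T := (~: S)%SET.

(** Inverse of z |-> (restr S z, restr T z). [insub] tests membership and supplies its proof; the
    final 0 is never reached. *)
Definition glue (x : bits (subreg S)) (y : bits (subreg T)) : bits I :=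
  [ffun k => if insub k is Some u then x u
             else if insub k is Some u' then y u' else 0].

Lemma restr_glue x y : restr S (glue x y) = x.
Proof. by apply/ffunP => k; rewrite !ffunE valK. Qed.

Lemma restrC_glue x y : restr T (glue x y) = y.
Proof.
apply/ffunP => -[k kT]; rewrite !ffunE /= insubN; last by rewrite inE in kT.
by rewrite (insubT (fun k => k \in T) kT).
Qed.

Lemma glue_restr z : glue (restr S z) (restr T z) = z.
Proof.
apply/ffunP => k; rewrite ffunE; case: insubP => [u _ <-|kS]; first by rewrite ffunE.
by case: insubP => [u _ <-|]; [rewrite ffunE | rewrite inE kS].
Qed.

Lemma sum_glue (V : nmodType) (F : bits I -> V) :
  \sum_z F z = \sum_x \sum_y F (glue x y).
Proof.
rewrite pair_bigA /= (reindex (fun xy => glue xy.1 xy.2)) //=.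
exists (fun z => (restr S z, restr T z)) => [[x y] _|z _] /=.
  by rewrite restr_glue restrC_glue.
by rewrite glue_restr.
Qed.

Lemma mix_glue (G : {set I}) x y x' y' :
  mix G (glue x y) (glue x' y') =
  glue (mix [set k | val k \in G]%SET x x') (mix [set k | val k \in G]%SET y y').
Proof.
apply/ffunP => k; rewrite !ffunE.
case: insubP => [u _ uk|_]; first by rewrite ffunE inE uk.
case: insubP => [u _ uk|_]; first by rewrite ffunE inE uk.
by case: ifP.
Qed.

Variable R : realType.

Lemma reducedE (rho : op R I) x x' :
  reduced S rho (enum_rank x) (enum_rank x') =
  \sum_y rho (enum_rank (glue x y)) (enum_rank (glue x' y)).
Proof.
rewrite mxE !enum_rankK big_mkcond sum_glue (bigD1 x) //=.
rewrite [X in _ + X]big1 ?addr0 => [|x1 x1x]; last first.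
  by rewrite big1 // => y _; rewrite restr_glue (negPf x1x).
apply: eq_bigr => y _; rewrite restr_glue eqxx.
rewrite big_mkcond sum_glue (bigD1 x') //=.
rewrite [X in _ + X]big1 ?addr0 => [|x1 x1x]; last first.
  by rewrite big1 // => y1 _; rewrite restr_glue (negPf x1x).
rewrite (bigD1 y) //= [X in _ + X]big1 ?addr0 => [|y1 y1y]; last first.
  by rewrite !restrC_glue (negPf y1y) andbF.
by rewrite !restr_glue !restrC_glue !eqxx.
Qed.

Lemma reducedCE (rho : op R I) y y' :
  reduced T rho (enum_rank y) (enum_rank y') =
  \sum_x rho (enum_rank (glue x y)) (enum_rank (glue x y')).
Proof.
(* [reduced T] compares strings on [~: T], a set equal to [S] only by a rewriting that changes the
   subregister type; the boolean equality test can be transported. *)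
have restrCC z w :
    (restr (~: T)%SET z == restr (~: T)%SET w) = (restr S z == restr S w).
  by rewrite finset.setCK.
rewrite mxE !enum_rankK big_mkcond sum_glue; apply: eq_bigr => x _.
rewrite (bigD1 y) //= [X in _ + X]big1 ?addr0 => [|y1 y1y]; last first.
  by rewrite restrC_glue (negPf y1y).
rewrite restrC_glue eqxx.
rewrite big_mkcond sum_glue (bigD1 x) //=.
rewrite [X in _ + X]big1 ?addr0 => [|x1 x1x]; last first.
  by rewrite big1 // => y1 _; rewrite restrCC !restr_glue (negPf x1x) andbF.
rewrite (bigD1 y') //= [X in _ + X]big1 ?addr0 => [|y1 y1y]; last first.
  by rewrite !restrC_glue (negPf y1y).
by rewrite restrCC !restr_glue !restrC_glue !eqxx.
Qed.

End Glue.

(** * Product measurements of a pure state *)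

Lemma adjmxM (R : realType) m n p (A : 'M[R[i]]_(m, n)) (B : 'M[R[i]]_(n, p)) :
  (A *m B)^t* = B^t* *m A^t*.
Proof. by rewrite trmx_mul map_mxM. Qed.

Lemma local_op_unitary (R : realType) (I : finType) (U : I -> 'M[R[i]]_2) :
  (forall k, U k \is unitarymx) -> local_op U \is unitarymx.
Proof.
move=> hU; apply/unitarymxP/matrixP => m n; rewrite !mxE sum_enum_rank.
pose x : bits I := enum_val m; pose y : bits I := enum_val n.
transitivity (\prod_k \sum_s U k (x k) s * (U k (y k) s)^*%R).
  (* Distributing the product over the sums factors each entry of L L^* qubit by qubit. *)
  rewrite bigA_distr_bigA /=; apply: eq_bigr => z _.
  by rewrite !mxE /= !enum_rankK rmorph_prod -big_split.
transitivity (\prod_k ((x k == y k)%:R : R[i])).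
  apply: eq_bigr => k _; move/unitarymxP: (hU k) => /matrixP/(_ (x k) (y k)).
  by rewrite !mxE => <-; apply: eq_bigr => s _; rewrite !mxE.
have [mn|mn] := eqVneq m n.
  by rewrite big1 // => k _; rewrite /x /y mn eqxx.
have /forallPn[k /negPf xyk] : ~~ [forall k, x k == y k].
  by apply: contra mn => /forallP h; apply/eqP/enum_val_inj/ffunP => k; apply/eqP.
by rewrite (bigD1 k) //= xyk mul0r.
Qed.

Section Measurement.
Variables (R : realType) (I : finType) (S : {set I}).
Variables (U : subreg (~: S)%SET -> 'M[R[i]]_2).
Hypothesis hU : forall k, U k \is unitarymx.
Variable v : ket R I.

Definition meas_ket (J : bits (subreg (~: S)%SET)) : ket R (subreg (~: S)%SET) :=
  (local_op U)^t* *m bket R J.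

Lemma meas_ketE J y : meas_ket J (enum_rank y) 0 = \prod_k (U k (J k) (y k))^*%R.
Proof.
rewrite mxE (bigD1 (enum_rank J)) //= [X in _ + X]big1 ?addr0 => [|m mJ]; last first.
  by rewrite [X in _ * X]mxE (negPf mJ) mulr0.
by rewrite !mxE !eqxx mulr1 /= !enum_rankK rmorph_prod.
Qed.

Lemma meas_ket_unit J :
  \sum_y meas_ket J (enum_rank y) 0 * (meas_ket J (enum_rank y) 0)^*%R = 1.
Proof.
rewrite -ket_norm /meas_ket adjmxM trmxCK mulmxA mulmxtVK ?local_op_unitary //.
rewrite mxE (bigD1 (enum_rank J)) //= [X in _ + X]big1 ?addr0 => [|m mJ]; last first.
  by rewrite !mxE (negPf mJ) mulr0.
by rewrite !mxE !eqxx mulr1 rmorph1.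
Qed.

(* <J|U applied to the qubits outside S. *)
Definition branch_ket (J : bits (subreg (~: S)%SET)) : ket R (subreg S) :=
  \col_m \sum_y (meas_ket J (enum_rank y) 0)^*%R
    * v (enum_rank (glue (enum_val m) y)) 0.

(** The product of two amplitudes is a double sum over outside strings [y], [y'], reindexed by
    exchanging their bits in G. The amplitudes of [v] are invariant by hypothesis, the coefficients
    because the outcome vector factors over the qubits. *)
Lemma branch_ket_product (G : {set I}) J :
  product_across G v -> product_across [set k | val k \in G]%SET (branch_ket J).
Proof.
move=> vG x x'; rewrite !mxE !enum_rankK !big_distrlr /=.
rewrite [RHS](big_swap_mix [set k | val k \in G]%SET).
apply: eq_bigr => y _; apply: eq_bigr => y' _.
rewrite mulrACA vG !mix_glue [RHS]mulrACA; congr (_ * _).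
rewrite !meas_ketE -!rmorphM -!big_split /=; congr (_^*%R); apply: eq_bigr => k _.
by rewrite !ffunE; case: ifP => _ //; rewrite mulrC.
Qed.

(** As a squared norm, the probability is nonnegative, and its square root normalises the branch. *)
Lemma outcome_probE J :
  outcome_prob U (proj v) J =
  \sum_x branch_ket J (enum_rank x) 0 * (branch_ket J (enum_rank x) 0)^*%R.
Proof.
rewrite /outcome_prob /expect.
transitivity (((meas_ket J)^t* *m reduced (~: S)%SET (proj v) *m meas_ket J) 0 0).
  by rewrite /meas_ket adjmxM trmxCK !mulmxA.
rewrite mxE sum_enum_rank.
under eq_bigr => y' _.
  rewrite mxE sum_enum_rank mulr_suml.
  under eq_bigr => y _.
    rewrite reducedCE mulr_sumr mulr_suml.
    under eq_bigr => x _ do rewrite proj_entry.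
    over.
  rewrite exchange_big /=.
  over.
rewrite exchange_big /=; apply: eq_bigr => x _.
rewrite !mxE enum_rankK rmorph_sum big_distrlr exchange_big /=.
apply: eq_bigr => y _; apply: eq_bigr => y' _.
have -> : ((meas_ket J)^t*) 0 (enum_rank y) = (meas_ket J (enum_rank y) 0)^*%R.
  by rewrite [LHS]mxE [in LHS]mxE.
by rewrite rmorphM /= conjCK; ring.
Qed.

(** The sum is the trace of L r L^*; cyclicity and unitarity reduce it to the trace of r, the
    squared norm of [v]. *)
Lemma sum_outcome_prob : v^t* *m v = 1%:M ->
  \sum_J outcome_prob U (proj v) J = 1.
Proof.
move=> /ket_unitP v1; pose L := local_op U; pose r := reduced (~: S)%SET (proj v).
have pE J : outcome_prob U (proj v) J = (L *m r *m L^t*) (enum_rank J) (enum_rank J).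
  rewrite /outcome_prob /expect -/L -/r /bket trmx_delta map_delta_mx.
  by rewrite -rowE -colE !mxE.
under eq_bigr do rewrite pE.
transitivity (\tr (L *m r *m L^t*)); first by rewrite /mxtrace sum_enum_rank.
rewrite mxtrace_mulC mulmxA.
have -> : L^t* *m L = 1%:M.
  by apply: mulmx1C; apply/unitarymxP/local_op_unitary.
rewrite mul1mx /mxtrace sum_enum_rank -v1 (sum_glue S) exchange_big /=.
by apply: eq_bigr => y _; rewrite reducedCE; apply: eq_bigr => x _; rewrite proj_entry.
Qed.

(** P v is the tensor product of [branch_ket J] and the unit vector [meas_ket J], so tracing out the
    latter leaves a pure state. *)
Lemma reduced_branch J :
  let P := tensor_op (S := S) (T := (~: S)%SET) 1%:M (proj (meas_ket J)) in
  reduced S (P *m proj v *m P^t*) = proj (branch_ket J).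
Proof.
move=> P; have -> : P *m proj v *m P^t* = proj (P *m v).
  by rewrite /proj adjmxM !mulmxA.
have Pv x y : (P *m v) (enum_rank (glue x y)) 0 =
    meas_ket J (enum_rank y) 0 * branch_ket J (enum_rank x) 0.
  rewrite mxE [branch_ket _ _ _]mxE enum_rankK sum_enum_rank (sum_glue S) (bigD1 x) //=.
  rewrite [X in _ + X]big1 ?addr0 => [|x1 x1x]; last first.
    rewrite big1 // => y1 _; rewrite mxE /= !enum_rankK !restr_glue !mxE.
    by rewrite (inj_eq enum_rank_inj) eq_sym (negPf x1x) !mul0r.
  rewrite mulr_sumr; apply: eq_bigr => y1 _.
  rewrite mxE /= !enum_rankK !restr_glue !restrC_glue proj_entry mxE eqxx.
  by rewrite mul1r mulrA.
apply/matrixP => m n; rewrite -(enum_valK m) -(enum_valK n) reducedE proj_entry.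
under eq_bigr => y _ do rewrite proj_entry !Pv rmorphM mulrACA.
by rewrite -mulr_suml meas_ket_unit mul1r.
Qed.

(** [g] is abstract so that the lemma serves both [fef] and the nested [f_ij]. *)
Lemma measured_mean_const (G : {set I}) (g : op R (subreg S) -> R) (c : R) :
    v^t* *m v = 1%:M -> product_across G v ->
    (forall w : ket R (subreg S), w^t* *m w = 1%:M ->
      product_across [set k | val k \in G]%SET w -> g (proj w) = c) ->
  measured_mean U g (proj v) = c.
Proof.
move=> v1 vG gc; rewrite /measured_mean.
transitivity (\sum_J complex.Re (outcome_prob U (proj v) J) * c); last first.
  by rewrite -mulr_suml -raddf_sum sum_outcome_prob //= mul1r.
apply: eq_bigr => J _.
(* At probability zero both terms vanish, whatever [g] returns. *)
have [->|p0] := eqVneq (outcome_prob U (proj v) J) 0; first by rewrite !mul0r.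
congr (_ * _).
pose p := outcome_prob U (proj v) J; pose d : R[i] := (sqrtC p)^-1.
have p_ge0 : 0 <= p.
  by rewrite /p outcome_probE sumr_ge0 // => x _; rewrite mul_conjC_ge0.
have dr : d^*%R = d by apply/CrealP; rewrite rpredV ger0_real ?sqrtC_ge0.
have dd : d * d = p^-1 by rewrite -expr2 exprVn sqrtCK.
have -> : post_state U (proj v) J = proj (d *: branch_ket J).
  rewrite /post_state reduced_branch -/p -dd.
  apply/matrixP => m n.
  by rewrite mxE !proj_entry ![(d *: branch_ket J) _ _]mxE rmorphM /= dr mulrACA.
apply: gc.
  apply/ket_unitP; rewrite -(mulVf p0) -/p -dd [X in _ = _ * X]outcome_probE mulr_sumr.
  apply: eq_bigr => x _.
  by rewrite ![(d *: branch_ket J) _ _]mxE rmorphM /= dr mulrACA.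
move=> x x'; rewrite ![(d *: branch_ket J) _ _]mxE mulrACA (branch_ket_product _ vG).
by rewrite mulrACA.
Qed.

End Measurement.

(** * Maximisation over measurements *)

Lemma assisted_const (R : realType) (I : finType) (S G : {set I}) (v : ket R I)
    (g : op R (subreg S) -> R) (c : R) :
    v^t* *m v = 1%:M -> product_across G v ->
    (forall w : ket R (subreg S), w^t* *m w = 1%:M ->
      product_across [set k | val k \in G]%SET w -> g (proj w) = c) ->
  assisted g (proj v) = c.
Proof.
move=> v1 vG gc; apply: maxr_eq => [|r [U hU ->]].
  (* The maximum is over the set {c}, provided it is inhabited; measuring in the computational basis
     shows this. *)
  have h1 (k : subreg (~: S)%SET) : (1%:M : 'M[R[i]]_2) \is unitarymx.
    by apply/unitarymxP; rewrite mul1mx trmx1 map_mx1.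
  by exists (fun=> 1%:M) => //; rewrite (measured_mean_const h1 v1 vG gc).
by rewrite (measured_mean_const hU v1 vG gc).
Qed.

Lemma f_ij_product (R : realType) (I : finType) (i j : I) (G : {set I}) (v : ket R I) :
    i != j -> i \in G -> j \notin G -> v^t* *m v = 1%:M -> product_across G v ->
  f_ij i j (proj v) = 2%:R^-1.
Proof.
move=> ij iG jG v1 vG; apply: (assisted_const v1 vG) => w w1 wG.
have iS : i \in [set i; j]%SET by rewrite !inE eqxx.
have jS : j \in [set i; j]%SET by rewrite !inE eqxx orbT.
apply: (fef_product (p := exist _ i iS) (q := exist _ j jS) _ _ _ _ w1 wG).
- by rewrite -val_eqE.
- move=> [k kS]; rewrite -!val_eqE /=.
  by have := kS : k \in [set i; j]%SET; rewrite !inE.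
- by rewrite inE.
- by rewrite inE.
Qed.

(** Measuring [k] leaves a vector that is a product across what remains of G, so [f_ij_product]
    applies on the smaller register. *)
Lemma fbar_ij_product (R : realType) (I : finType) (i j : I) (G : {set I})
    (v : ket R I) :
    (3 <= #|I|)%N -> i != j -> i \in G -> j \notin G ->
    v^t* *m v = 1%:M -> product_across G v ->
  fbar_ij i j (proj v) = 2%:R^-1.
Proof.
move=> I3 ij iG jG v1 vG.
have mean k (hi : i \in [set~ k]%SET) (hj : j \in [set~ k]%SET) :
    assisted (S := [set~ k]%SET)
      (f_ij (exist _ i hi : subreg [set~ k]%SET) (exist _ j hj)) (proj v) = 2%:R^-1.
  apply: (assisted_const v1 vG) => w w1; apply: f_ij_product w1.
  - by rewrite -val_eqE.
  - by rewrite inE.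
  - by rewrite inE.
apply: maxr_eq => [/=|r [k [hi [hj ->]]]]; last by rewrite mean.
(* With at least three qubits there is some [k] to measure first, so the set of values is
   nonempty. *)
have /card_gt0P[k] : (0 < #|~: [set i; j]%SET|)%N.
  by rewrite cardsCs finset.setCK cards2 ij subn_gt0.
rewrite !inE negb_or => /andP[ki kj].
have hi : i \in [set~ k]%SET by rewrite !inE eq_sym.
have hj : j \in [set~ k]%SET by rewrite !inE eq_sym.
by exists k, hi, hj; rewrite mean.
Qed.

Theorem proposition8 (R : realType) (N : nat) (hN : (4 <= N)%N)
    (phi : ket R 'I_N) (hphi : phi^t* *m phi = 1%:M)
    (i j : 'I_N) (hij : i != j)
    (Gi Gj : {set 'I_N})
    (hcover : (Gi :|: Gj)%SET = [set: 'I_N]%SET) (hdisj : [disjoint Gi & Gj])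
    (hi : i \in Gi) (hj : j \in Gj)
    (hsep : SEP Gi Gj phi) :
  F_ij i j (proj phi) = Fbar_ij i j (proj phi) /\
  Fbar_ij i j (proj phi) = 2%:R / 3%:R.
Proof.
have Gj_Gi : Gj = (~: Gi)%SET.
  apply/setP => k; rewrite inE; move/setP/(_ k): hcover; rewrite !inE.
  by case kGi: (k \in Gi) => //= _; apply: (disjointFr hdisj).
subst Gj; have phiG := sep_product hsep.
have jG : j \notin Gi by move: hj; rewrite !inE.
rewrite /F_ij /Fbar_ij (f_ij_product hij hi jG hphi phiG).
rewrite (fbar_ij_product _ hij hi jG hphi phiG) ?card_ord ?(ltnW hN) //.
(* 2 * (1/2) + 1 = 2. *)
by rewrite mulfV ?pnatr_eq0 // -natrD.
Qed.
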